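(* Let $G_0^*$ be a $k$-uniform hypergraph on $n$ vertices and let $\{U_1,\dots,U_t\}$ be a partition of its vertex set into $t$ sets of size $p$ (so $n=pt$). Order the vertices of $G_0^*$ so that $U_i$ consists of the $((i-1)p+1)$-th through the $(ip)$-th vertices, and compute $S(G_0^* )$ in this order. For $i=1,\dots,t$ let $G_i^*$ be a $(k,r)$-regular hypergraph on $m\ge 2$ vertices (same $k,r,m$ for all $i$). Put $$a=\begin{cases} p\left(\binom{p+m-2}{k-2}-\binom{p-2}{k-2}\right) & \text{if } p\ge 2,\\ 0 & \text{if } p=1,\end{cases}\qquad b=\binom{p+m-2}{k-2},\qquad c=\binom{p+m-2}{k-2}-\binom{m-2}{k-2},$$ $Y_{S_i}=S(G_i^* )-2c(J_m-I_m)$, and $h=h(\mu)=-(1+2r(k-1)+2c(m-1)+\mu)$. Let $G^*=G_0^*\odot_p^t G_i^*$ be the generalized corona. Then for every real $\mu$ such that $Y_{S_i}-J_m-\mu I_m$ is invertible for every $i$, $h\neq 0$ and $h+pmt\neq 0$, $$P_{S(G^* )}(\mu)=\Big(1+\frac{pmt}{h}\Big)\Big(\prod_{i=1}^t\det(Y_{S_i}-J_m-\mu I_m)\Big)^p\det\!\Big(S(G_0^* )+I_t\otimes\Big(-\big(2a+\tfrac{4pmb^2}{h}\big)J_p+(2a-\mu)I_p\Big)-\frac{pm}{h}\Big((t-4b)-\frac{pm(t-2b)^2}{h+pmt}\Big)J_n\Big).$$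
   Context: All hypergraphs are finite and simple: a hypergraph $G^*=(V,E)$ consists of a finite vertex set $V$ and a set $E$ of subsets of $V$ (hyperedges), each of size at least $2$. It is $k$-uniform if every hyperedge has exactly $k$ elements, and $(k,r)$-regular if it is $k$-uniform and every vertex lies in exactly $r$ hyperedges. For a hypergraph with vertices $v_1,\dots,v_n$, the adjacency matrix $A(G^* )$ is the $n\times n$ matrix whose $(i,j)$ entry, for $i\ne j$, is the number of hyperedges containing both $v_i$ and $v_j$, and whose diagonal entries are $0$; the Seidel matrix is $S(G^* )=J_n-I_n-2A(G^* )$. $J_n$ (resp. $J_{a,b}$) is the all-ones $n\times n$ (resp. $a\times b$) matrix, $I_n$ the identity matrix, $\otimes$ the Kronecker product. For a square matrix $M$, $P_M(\mu)=\det(M-\mu I)$. Binomial coefficients $\binom{x}{y}$ with integers $x\ge 0$ and $y$ are $0$ when $y<0$ or $y>x$. Generalized corona: let $G_0^*$ be a $k$-uniform hypergraph with vertex set $V_0$, $\{U_1,\dots,U_t\}$ a partition of $V_0$ with $|U_i|=p$, and $G_1^*,\dots,G_t^*$ $k$-uniform hypergraphs. The generalized corona $G_0^*\odot_p^t G_i^*$ is the $k$-uniform hypergraph obtained as follows: for each $i$ take $p$ copies $G_i^{*(1)},\dots,G_i^{*(p)}$ of $G_i^*$, all copies pairwise vertex-disjoint and disjoint from $V_0$. The vertex set is $V_0$ together with the vertices of all copies; the hyperedges are the hyperedges of $G_0^*$, the hyperedges of every copy, and, for every $i\in\{1,\dots,t\}$ and $j\in\{1,\dots,p\}$, every $k$-element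 subset of $U_i\cup V(G_i^{*(j)})$ that meets both $U_i$ and $V(G_i^{*(j)})$. *)

(* Defs.v *)
From HB Require Import structures.
From mathcomp Require Import all_boot all_order all_algebra.
From mathcomp Require Import mxtens.
Set Implicit Arguments. Unset Strict Implicit. Unset Printing Implicit Defensive.
Import Order.TTheory GRing.Theory Num.Theory.
Local Open Scope ring_scope.

(* A hypergraph on a finite vertex type T is given by its set of hyperedges
   E : {set {set T}}; simplicity is automatic (E is a set). *)
Definition is_hypergraph (T : finType) (E : {set {set T}}) : Prop :=
  forall e, e \in E -> (2 <= #|e|)%N.

Definition uniform (T : finType) (k : nat) (E : {set {set T}}) : Prop :=
  forall e, e \in E -> #|e| = k.

Definition regular (T : finType) (k r : nat) (E : {set {set T}}) : Prop :=
  uniform k E /\ forall v : T, #|[set e in E | v \in e]| = r.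

(* Adjacency / Seidel matrix w.r.t. a vertex ordering f : 'I_n -> T
   (f is a bijection in all uses below). *)
Definition adjmx (R : pzRingType) (T : finType) (n : nat) (f : 'I_n -> T)
  (E : {set {set T}}) : 'M[R]_n :=
  \matrix_(i, j) (if i == j then 0
                  else (#|[set e in E | (f i \in e) && (f j \in e)]|)%:R).

Definition seidelmx (R : pzRingType) (T : finType) (n : nat) (f : 'I_n -> T)
  (E : {set {set T}}) : 'M[R]_n :=
  const_mx 1 - 1%:M - 2%:R *: adjmx R f E.

Definition seidel (R : pzRingType) (n : nat) (E : {set {set 'I_n}}) : 'M[R]_n :=
  seidelmx R id E.

Definition seidelT (R : pzRingType) (T : finType) (E : {set {set T}}) :
  'M[R]_#|T| := seidelmx R (@enum_val T (pred_of_simpl predT)) E.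

Definition charP (R : comPzRingType) (n : nat) (M : 'M[R]_n) (mu : R) : R :=
  \det (M - mu%:M).

Definition binz (x : nat) (y : int) : nat :=
  match y with Posz y' => 'C(x, y') | Negz _ => 0%N end.

(* Generalized corona G0 (.)_p^t G_i.
   Vertices of G0: 'I_(t*p), with U_i = {v | v / p = i} (i.e. U_i is the
   i-th block of p consecutive vertices).
   Vertex inr (i, j, v) is vertex v of the j-th copy of G_i. *)
Definition corona_vtx (t p m : nat) : finType :=
  ('I_(t * p) + ('I_t * 'I_p * 'I_m))%type.

Definition blockU (t p : nat) (i : 'I_t) : {set 'I_(t * p)} :=
  [set v : 'I_(t * p) | (v %/ p)%N == i].
Arguments blockU t p i : clear implicits.

Definition corona_edges (t p m k : nat) (E0 : {set {set 'I_(t * p)}})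
  (E : 'I_t -> {set {set 'I_m}}) : {set {set corona_vtx t p m}} :=
  [set S : {set corona_vtx t p m} |
     [exists e in E0, S == [set (inl v : corona_vtx t p m) | v in e]]
  || [exists i : 'I_t, exists j : 'I_p, exists e in E i,
        S == [set (inr (i, j, v) : corona_vtx t p m) | v in e]]
  || [exists i : 'I_t, exists j : 'I_p,
        let Ui := [set (inl v : corona_vtx t p m) | v in blockU t p i] in
        let Cij := [set (inr (i, j, v) : corona_vtx t p m) | v : 'I_m] in
        [&& #|S| == k, S \subset Ui :|: Cij, S :&: Ui != set0
          & S :&: Cij != set0]]].

Arguments corona_edges t p m k E0 E : clear implicits.

(* Main.v *)
(* Order the vertices of the corona as V_0 followed by the copies.  Then the
   Seidel matrix minus mu I is [[A, B], [B^T, D]], where D = J + D0 and D0 is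
   block diagonal with blocks Y_{S_i} - J - mu I, each repeated p times.
   Regularity of the G_i gives every column of D0 the sum h, whence
   det D = (1 + pmt/h) det D0.  The row of B at u in U_i is 1 - 2b on the copies
   attached to U_i and 1 elsewhere, so X = B/h - s J with
   s = pm(t - 2b) / (h (h + pmt)) satisfies X D = B, and A - X B^T is the matrix
   in the last determinant. *)
Require Import Defs.
From HB Require Import structures.
From mathcomp Require Import all_boot all_order all_algebra.
From mathcomp Require Import mxtens.
From mathcomp Require Import perm ring zify.
Import Order.TTheory GRing.Theory Num.Theory.
Local Open Scope ring_scope.

(** * Determinants indexed by finite types *)

Lemma big_fin_ord {R : Type} {idx : R} {op : Monoid.com_law idx} {T : finType}
    (F : T -> R) :
  \big[op/idx]_x F x = \big[op/idx]_(i < #|T|) F (enum_val i).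
Proof.
exact: (reindex (@enum_val T (pred_of_simpl predT)) (onW_bij _ (enum_val_bij T))).
Qed.

(** Arbitrary finite index types let block matrices be indexed by sums and products of types; the
    order of enumeration is immaterial by [det_fdet]. *)
Definition fdet {R : comPzRingType} {T : finType} (F : T -> T -> R) : R :=
  \det (\matrix_(i < #|T|, j < #|T|) F (enum_val i) (enum_val j)).

Lemma eq_fdet {R : comPzRingType} {T : finType} {F G : T -> T -> R} :
  (forall x y, F x y = G x y) -> fdet F = fdet G.
Proof. by move=> FG; congr (\det _); apply/matrixP=> i j; rewrite !mxE FG. Qed.

(** A change of enumeration applies the same permutation [s] to rows and columns, so its sign occurs
    twice and cancels. *)
Lemma det_fdet {R : comPzRingType} {T : finType} {n : nat} {f : 'I_n -> T}
    (F : T -> T -> R) :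
  bijective f -> \det (\matrix_(i, j) F (f i) (f j)) = fdet F.
Proof.
move=> f_bij; have Dn : n = #|T| by rewrite -(bij_eq_card f_bij) card_ord.
subst n; pose s := perm (inj_comp enum_rank_inj (bij_inj f_bij)).
rewrite /fdet; set A := (X in _ = \det X).
have -> : \matrix_(i, j) F (f i) (f j) = row_perm s (col_perm s A).
  by apply/matrixP=> i j; rewrite !mxE !permE /= !enum_rankK.
rewrite row_permE col_permE !det_mulmx !det_perm odd_permV.
by rewrite mulrCA -signr_addb addbb mulr1.
Qed.

Lemma fdet_ord {R : comPzRingType} {n : nat} (A : 'M[R]_n) : fdet A = \det A.
Proof.
rewrite -(@det_fdet _ _ _ id); last by exists id.
by congr (\det _); apply/matrixP=> i j; rewrite mxE.
Qed.

Lemma fdet_reindex {R : comPzRingType} {S T : finType} {g : S -> T}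
    (F : T -> T -> R) :
  bijective g -> fdet (fun x y => F (g x) (g y)) = fdet F.
Proof.
by move=> g_bij; rewrite -(det_fdet F (bij_comp g_bij (@enum_val_bij S))).
Qed.

(* X plays the role of B D^-1 for F = [[A, B], [C, D]], so that D need not be
   invertible. *)
Lemma fdet_schur {R : comPzRingType} {S T : finType} {F : S + T -> S + T -> R}
    (X : S -> T -> R) :
    (forall x z, \sum_y X x y * F (inr y) (inr z) = F (inl x) (inr z)) ->
  fdet F = fdet (fun x y => F (inl x) (inl y)
                              - \sum_z X x z * F (inr z) (inl y))
           * fdet (fun x y => F (inr x) (inr y)).
Proof.
move=> XF.
pose g (i : 'I_(#|S| + #|T|)) : S + T :=
  match split i with inl x => inl (enum_val x) | inr x => inr (enum_val x) end.
have gl x : g (lshift _ x) = inl (enum_val x).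
  by rewrite /g; case: split_ordP => i /eqP;
     rewrite ?eq_lrshift // (inj_eq (@lshift_inj _ _)) => /eqP->.
have gr x : g (rshift _ x) = inr (enum_val x).
  by rewrite /g; case: split_ordP => i /eqP;
     rewrite ?eq_rlshift // (inj_eq (@rshift_inj _ _)) => /eqP->.
have g_bij : bijective g.
  pose g' (x : S + T) := match x with inl x => lshift #|T| (enum_rank x)
                                    | inr x => rshift #|S| (enum_rank x) end.
  exists g' => [i|[x|x]]; last 2 first.
  - by rewrite gl enum_rankK.
  - by rewrite gr enum_rankK.
  by rewrite /g; case: split_ordP => x -> /=; rewrite enum_valK.
rewrite -(det_fdet F g_bij).
set M := (X in \det X).
pose N : 'M[R]_(#|S|, #|T|) := \matrix_(i, j) X (enum_val i) (enum_val j).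
(* Left multiplication by this unipotent matrix keeps the determinant and, by [XF], clears the upper
   right block. *)
have -> : \det M = \det (block_mx 1%:M (- N) 0 1%:M *m M).
  by rewrite det_mulmx det_ublock !det1 !mul1r.
rewrite -[M in _ *m M]submxK mulmx_block !mul1mx !mul0mx !add0r.
have -> : ursubmx M + - N *m drsubmx M = 0.
  apply/matrixP=> i j; rewrite !mxE gl gr -XF big_fin_ord.
  rewrite -big_split big1 //= => z _.
  by rewrite !mxE !gr mulNr addrN.
rewrite det_lblock; congr (_ * _); congr (\det _); apply/matrixP=> i j.
  rewrite !mxE !gl; congr (_ + _).
  rewrite [in RHS]big_fin_ord -sumrN.
  by apply: eq_bigr => z _; rewrite !mxE gr gl mulNr.
by rewrite !mxE !gr.
Qed.

Lemma fdet_unit {R : comPzRingType} (F : unit -> unit -> R) : fdet F = F tt tt.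
Proof.
have bij_tt : bijective (fun _ : 'I_1 => tt).
  by exists (fun=> ord0) => [i|[]] //; rewrite (ord1 i).
by rewrite -(det_fdet F bij_tt) det_mx11 mxE.
Qed.

(* Both sides are Schur complements in the matrix A bordered by a row of ones,
   a column of minus ones and a corner 1. *)
Lemma fdet_add1 {F : fieldType} {T : finType} {A : T -> T -> F} {h : F} :
    h != 0 -> (forall y, \sum_x A x y = h) ->
  fdet (fun x y => 1 + A x y) = (1 + #|T|%:R / h) * fdet A.
Proof.
move=> h0 Ah.
pose B (x y : T + unit) : F := match x, y with
  | inl x, inl y => A x y | inl _, inr _ => -1 | inr _, _ => 1 end.
pose sw (x : unit + T) : T + unit :=
  match x with inl x => inr x | inr x => inl x end.
have sw_bij : bijective sw.
  by exists (fun x => match x with inl x => inr x | inr x => inl x end); case.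
have := fdet_reindex B sw_bij.
(* Pivot on [A]: its columns sum to [h], so the constant row [h^-1] times [A] is the row of ones. *)
rewrite (fdet_schur (fun _ _ => h^-1)); last first.
  by move=> [] z /=; rewrite -mulr_sumr Ah mulVf.
(* Pivot on the corner 1: the complement is [A] plus the all-ones matrix. *)
rewrite (@fdet_schur _ _ _ B (fun _ _ => -1)); last first.
  by move=> x [] /=; rewrite sumr_const card_unit mulr1.
rewrite !fdet_unit /= mulr1 => E; apply/esym; etransitivity; last first.
  etransitivity; first exact: E.
  apply: eq_fdet => x y; rewrite sumr_const card_unit.
  by rewrite mulr1 opprK addrC.
by rewrite sumr_const mulrN1 mulNrn opprK mulr_natl.
Qed.

(** Induction on the number of blocks for an ordinal index: off-diagonal blocks vanish, so
    [fdet_schur] with [X = 0] splits off the first block. Enumerating [I] gives the general case. *)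
Lemma fdet_blocks {R : comPzRingType} {I T : finType} (A : I -> T -> T -> R) :
  fdet (fun x y : I * T => if x.1 == y.1 then A x.1 x.2 y.2 else 0)
  = \prod_i fdet (A i).
Proof.
have ord_blocks n (B : 'I_n -> T -> T -> R) :
    fdet (fun x y : 'I_n * T => if x.1 == y.1 then B x.1 x.2 y.2 else 0)
    = \prod_i fdet (B i).
  elim: n B => [|n IHn] B.
    rewrite big_ord0 /fdet; move: (\matrix_(_, _) _).
    by rewrite card_prod card_ord => M; rewrite det_mx00.
  pose g (x : T + 'I_n * T) : 'I_n.+1 * T :=
    match x with inl x => (ord0, x) | inr x => (lift ord0 x.1, x.2) end.
  have g_bij : bijective g.
    exists (fun x => if unlift ord0 x.1 is Some i then inr (i, x.2)
                     else inl x.2).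
      by case=> [x|[i x]] /=; rewrite ?unlift_none ?liftK.
    by case=> i x /=; case: unliftP => [j|] ->.
  rewrite big_ord_recl -IHn -(fdet_reindex _ g_bij).
  rewrite (fdet_schur (fun _ _ => 0)) /=; last first.
    by move=> x z; rewrite big1 // => y _; rewrite mul0r.
  congr (_ * _); apply: eq_fdet => x y.
  by rewrite big1 ?subr0 ?eqxx // => z _; rewrite mul0r.
have g_bij : bijective (fun x : 'I_#|I| * T => (enum_val x.1, x.2)).
  by exists (fun x => (enum_rank x.1, x.2)) => [] [i x];
     rewrite /= ?enum_valK ?enum_rankK.
rewrite -(fdet_reindex _ g_bij) /= [RHS]big_fin_ord.
rewrite -ord_blocks; apply: eq_fdet => x y.
by rewrite (inj_eq enum_val_inj).
Qed.

(** * Codegrees: the off-diagonal entries of adjacency matrices *)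

Definition codeg {T : finType} (E : {set {set T}}) (x y : T) : nat :=
  #|[set e in E | (x \in e) && (y \in e)]|.

Lemma codegC {T : finType} (E : {set {set T}}) x y : codeg E x y = codeg E y x.
Proof.
by congr #|pred_of_set _|; apply/setP=> e; rewrite !inE [_ && (y \in e)]andbC.
Qed.

(** A sum of indicators turns unions, images and double counting into operations on sums. *)
Lemma codegE {T : finType} (E : {set {set T}}) x y :
  codeg E x y = (\sum_(e in E) ((x \in e) && (y \in e)))%N.
Proof.
rewrite /codeg -sum1_card.
rewrite [RHS](bigID (fun e : {set T} => (x \in e) && (y \in e))) /=.
rewrite [X in (_ + X)%N]big1 => [|e /andP[_ /negPf->]] //; rewrite addn0.
by apply: eq_big => e; rewrite inE // => /andP[_ ->].
Qed.

Lemma codegU {T : finType} (E F : {set {set T}}) x y :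
  [disjoint E & F] -> codeg (E :|: F) x y = (codeg E x y + codeg F x y)%N.
Proof.
by move=> EF; rewrite !codegE -bigU //; apply: eq_bigl => e; rewrite !inE.
Qed.

Lemma codeg_bigcup {T I : finType} (F : I -> {set {set T}}) x y :
    (forall i j, i != j -> [disjoint F i & F j]) ->
  codeg (\bigcup_i F i) x y = (\sum_i codeg (F i) x y)%N.
Proof.
move=> disF; rewrite codegE partition_disjoint_bigcup //.
by apply: eq_bigr => i _; rewrite codegE.
Qed.

Lemma codeg_eq0 {T : finType} (E : {set {set T}}) x y :
  (forall e, e \in E -> x \in e -> y \in e -> False) -> codeg E x y = 0%N.
Proof.
move=> E0; rewrite codegE big1 // => e eE.
by case xe: (x \in e); case ye: (y \in e) => //; case: (E0 e).
Qed.

Lemma codeg_imset {S T : finType} (f : S -> T) (E : {set {set S}}) x y :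
    injective f ->
  codeg [set f @: (e : {set S}) | e in E] (f x) (f y) = codeg E x y.
Proof.
move=> f_inj; rewrite !codegE big_imset /=; last first.
  by move=> e1 e2 _ _ /(imset_inj f_inj).
by apply: eq_bigr => e _; rewrite !mem_imset.
Qed.

(** Double counting of pairs [(y, e)] with [x] and [y] in [e]: each of the [r] edges through [x] has
    [k] vertices, and [y = x] accounts for the summand [r]. *)
Lemma sum_codeg {T : finType} {k r : nat} {E : {set {set T}}} (x : T) :
  regular k r E -> (\sum_(y | y != x) codeg E x y + r = r * k)%N.
Proof.
case=> Ek Er; rewrite -[X in (_ + X)%N](Er x).
have -> : #|[set e in E | x \in e]| = codeg E x x.
  by congr #|pred_of_set _|; apply/setP=> e; rewrite !inE andbb.
have <- : (\sum_y codeg E x y = \sum_(y | y != x) codeg E x y + codeg E x x)%N.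
  by rewrite addnC (bigD1 x).
rewrite -(Er x) -sum_nat_const.
under eq_bigr do rewrite codegE.
rewrite exchange_big [LHS](bigID (fun e : {set T} => x \in e)) /=.
rewrite [X in (_ + X)%N]big1 => [|e /andP[_ /negPf->]]; last by rewrite big1.
rewrite addn0; apply: eq_big => [e|e /andP[eE xe]]; first by rewrite inE.
by rewrite xe /= -big_mkcond /= sum1_card Ek.
Qed.

(** Deleting [x] and [y] matches these sets with the subsets of [A :\: [set x; y]] of size
    [k - 2]. *)
Lemma card_draws_pair {T : finType} (A : {set T}) (k : nat) x y :
    x != y -> x \in A -> y \in A ->
  codeg [set S : {set T} | (#|S| == k) && (S \subset A)] x y
  = binz (#|A| - 2) (k%:Z - 2).
Proof.
move=> xy xA yA.
have xyA : [set x; y] \subset A by apply/subsetP=> z /set2P[]->.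
(* For [k < 2] no set of size [k] contains both points, and [binz] is 0 at a negative second
   argument. *)
case: k => [|[|k]].
- apply: codeg_eq0 => S; rewrite inE cards_eq0 => /andP[/eqP-> _].
  by rewrite inE.
- apply: codeg_eq0 => S; rewrite inE => /andP[/cards1P[z ->] _].
  by move=> /set1P xz /set1P yz; rewrite xz yz eqxx in xy.
have -> : k.+2%:Z - 2 = k%:Z by lia.
rewrite /binz; have -> : (#|A| - 2 = #|A :\: [set x; y]|)%N.
  by rewrite cardsD (setIidPr xyA) cards2 xy.
rewrite -cards_draws /codeg.
set D := (X in _ = #|pred_of_set X|).
rewrite -(@card_in_imset _ _ (fun B : {set T} => [set x; y] :|: B) D); last first.
  move=> B C; rewrite !inE !subsetD => /andP[/andP[_ dB] _] /andP[/andP[_ dC] _].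
  move=> /(congr1 (fun S => S :\: [set x; y])).
  by rewrite /= !(setDUl [set x; y]) setDv !set0U (setDidPl dB) (setDidPl dC).
congr #|pred_of_set _|; apply/setP=> S; apply/idP/imsetP.
  rewrite !inE => /andP[/andP[/eqP Sk SA] /andP[xS yS]].
  have xyS : [set x; y] \subset S by apply/subsetP=> z /set2P[]->.
  exists (S :\: [set x; y]); last by rewrite -{1}(setID S [set x; y]) (setIidPr xyS).
  by rewrite inE setSD //= cardsD (setIidPr xyS) cards2 xy Sk subn2.
case=> B; rewrite !inE subsetD => /andP[/andP[BA dB] /eqP Bk] ->.
rewrite !inE !eqxx orbT /= subUset xyA BA !andbT.
by rewrite cardsU disjoint_setI0 1?disjoint_sym // cards0 subn0 cards2 xy Bk.
Qed.

(** With [U] a block and [C] an attached copy, these are the joining hyperedges of the corona.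
    Arbitrary sets allow the two roles to be exchanged. *)
Definition mixed {T : finType} (k : nat) (U C : {set T}) : {set {set T}} :=
  [set S : {set T} | [&& #|S| == k, S \subset U :|: C, S :&: U != set0
                       & S :&: C != set0]].

Lemma mixedC {T : finType} (k : nat) (U C : {set T}) : mixed k U C = mixed k C U.
Proof. by apply/setP=> S; rewrite !inE setUC [(_ != set0) && _]andbC. Qed.

(** A set through [x] and [y] meets both sides automatically, so only [card_draws_pair] on the union
    is left. *)
Lemma codeg_mixed_cross {T : finType} (k : nat) (U C : {set T}) x y :
    [disjoint U & C] -> x \in U -> y \in C ->
  codeg (mixed k U C) x y = binz (#|U| + #|C| - 2) (k%:Z - 2).
Proof.
move=> UC xU yC; have xy : x != y.
  by apply: contraTneq yC => <-; rewrite (disjointFr UC).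
rewrite -(cardsUI U C) (disjoint_setI0 UC) cards0 addn0.
rewrite -(@card_draws_pair _ _ _ x y) ?inE ?xU ?yC ?orbT //.
congr #|pred_of_set _|; apply/setP=> S; rewrite !inE.
case xS: (x \in S); last by rewrite !andbF.
case yS: (y \in S); last by rewrite !andbF.
have -> : S :&: U != set0 by apply/set0Pn; exists x; rewrite inE xS.
have -> : S :&: C != set0 by apply/set0Pn; exists y; rewrite inE yS.
by rewrite !andbT.
Qed.

(** Every [k]-subset of the union through [x] and [y] meets [U]; those that miss [C] are exactly the
    ones inside [U]. *)
Lemma codeg_mixed_same {T : finType} (k : nat) (U C : {set T}) x y :
    [disjoint U & C] -> x != y -> x \in U -> y \in U ->
  (codeg (mixed k U C) x y + binz (#|U| - 2) (k%:Z - 2)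
   = binz (#|U| + #|C| - 2) (k%:Z - 2))%N.
Proof.
move=> UC xy xU yU.
rewrite -(cardsUI U C) (disjoint_setI0 UC) cards0 addn0.
rewrite -(@card_draws_pair _ (U :|: C) _ x y) ?inE ?xU ?yU //.
rewrite -(@card_draws_pair _ U _ x y) //.
rewrite -codegU; last first.
  rewrite disjoints_subset; apply/subsetP=> S; rewrite !inE.
  move=> /and4P[_ _ _ /set0Pn[z /setIP[zS zC]]]; apply/negP => /andP[_ /subsetP].
  by move=> /(_ z zS); rewrite (disjointFl UC).
congr #|pred_of_set _|; apply/setP=> S; rewrite !inE.
case xS: (x \in S); last by rewrite !andbF.
case: eqP => //= _.
have -> /= : S :&: U != set0 by apply/set0Pn; exists x; rewrite inE xS.
congr (_ && _); have [SU|nSU] := boolP (S \subset U).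
  by rewrite orbT (subset_trans SU) ?subsetUl.
rewrite orbF andb_idr // => /subsetP SUC.
have [z zS zU] := subsetPn nSU; apply/set0Pn; exists z.
by have := SUC z zS; rewrite !inE zS (negPf zU).
Qed.

Lemma codeg_mixed_out {T : finType} (k : nat) (U C : {set T}) x y :
  x \notin U :|: C -> codeg (mixed k U C) x y = 0%N.
Proof.
move=> xUC; apply: codeg_eq0 => S; rewrite inE => /and4P[_ /subsetP SUC _ _].
by move=> /SUC xin; rewrite xin in xUC.
Qed.

(** * Codegrees in the generalized corona *)

Definition blk {t p : nat} (u : 'I_(t * p)) : 'I_t := (mxtens_unindex u).1.

(** Each component of the corona becomes the image of one injective map, [vinl] for the base and
    [vinr q] for the copy [q = (i, j)], as [codeg_imset] requires. *)
Definition vinl {t p m : nat} (u : 'I_(t * p)) : corona_vtx t p m := inl u.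
Definition vinr {t p m : nat} (q : 'I_t * 'I_p) (v : 'I_m) :
  corona_vtx t p m := inr (q, v).

Definition base_block (t p m : nat) (i : 'I_t) : {set corona_vtx t p m} :=
  [set vinl u | u in blockU t p i].
Definition copy_vtx (t p m : nat) (q : 'I_t * 'I_p) :
  {set corona_vtx t p m} := [set vinr q v | v in 'I_m].

Lemma corona_edgesE (t p m k : nat) (E0 : {set {set 'I_(t * p)}})
    (E : 'I_t -> {set {set 'I_m}}) :
  corona_edges t p m k E0 E
  = [set vinl @: (e : {set _}) | e in E0]
    :|: (\bigcup_q [set vinr q @: (e : {set _}) | e in E q.1])
    :|: \bigcup_q mixed k (base_block t p m q.1) (copy_vtx t p m q).
Proof.
apply/setP=> S; rewrite !inE; congr (_ || _ || _).
- apply/exists_inP/imsetP => [[e eE /eqP ->]|[e eE ->]]; first by exists e.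
  by exists e.
- apply/existsP/bigcupP => [[i /existsP[j /exists_inP[e eE /eqP ->]]]|].
    by exists (i, j) => //; apply/imsetP; exists e.
  case=> [[i j] _ /imsetP[e eE ->]]; exists i; apply/existsP; exists j.
  by apply/exists_inP; exists e.
- apply/existsP/bigcupP => [[i /existsP[j Sij]]|].
    by exists (i, j); rewrite ?inE.
  by case=> [[i j] _]; rewrite inE => Sij; exists i; apply/existsP; exists j.
Qed.

Section CoronaCodegree.

Context {t p m k : nat} {E0 : {set {set 'I_(t * p)}}}.
Context {E : 'I_t -> {set {set 'I_m}}}.
Context (E_graph : forall i, is_hypergraph (E i)).

Let corona := corona_edges t p m k E0 E.
Let binB := binz (p + m - 2) (k%:Z - 2).

Lemma mem_vinl_base u i :
  (vinl u \in base_block t p m i) = (blk u == i).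
Proof.
(* The value of [blk u] is [u %/ p] by computation; [blk] goes through [mxtens_unindex] to agree
   with the indexing of [tensmx]. *)
by rewrite mem_imset => [|x y []//]; rewrite inE -val_eqE.
Qed.

Lemma mem_vinr_base q v i : vinr q v \in base_block t p m i = false.
Proof. by apply/imsetP=> -[]. Qed.

Lemma mem_vinl_copy u q : vinl u \in copy_vtx t p m q = false.
Proof. by apply/imsetP=> -[]. Qed.

Lemma mem_vinr_copy q' v q : (vinr q' v \in copy_vtx t p m q) = (q' == q).
Proof.
apply/imsetP/eqP => [[w _ [-> _]]|->] //.
by exists v.
Qed.

Lemma disjoint_base_copy i q :
  [disjoint base_block t p m i & copy_vtx t p m q].
Proof.
by apply/pred0P => -[u|[q' v]] /=;
   rewrite ?(mem_vinl_copy u) ?(mem_vinr_base q' v) ?andbF.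
Qed.

Lemma card_base_block i : #|base_block t p m i| = p.
Proof.
rewrite card_imset; last by move=> x y [].
rewrite -[RHS]card_ord -(@card_imset _ _ (fun j : 'I_p => mxtens_index (i, j))).
  congr #|pred_of_set _|; apply/setP=> u; rewrite inE.
  case: (mxtens_indexP u) => i' j; apply/idP/imsetP => [/eqP/=|[j' _ ->]].
    move=> ii'; exists j => //; congr mxtens_index; congr (_, _).
    apply/val_inj; rewrite /= -ii'.
    by have /(congr1 (fun x => val x.1)) /= -> := mxtens_indexK (i', j).
  by have /(congr1 (fun x => val x.1)) /= -> := mxtens_indexK (i, j').
by move=> j j' /(can_inj (@mxtens_indexK _ _))[].
Qed.

Lemma card_copy_vtx q : #|copy_vtx t p m q| = m.
Proof. by rewrite card_imset ?card_ord // => x y []. Qed.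

(** The families are disjoint: base edges avoid all copies, copy edges are nonempty and lie in a
    single copy, and joining edges meet both the base and exactly one copy. *)
Lemma codeg_corona x y :
  codeg corona x y
  = (codeg [set vinl @: (e : {set _}) | e in E0] x y
     + \sum_q codeg [set vinr q @: (e : {set _}) | e in E q.1] x y
     + \sum_q codeg (mixed k (base_block t p m q.1) (copy_vtx t p m q)) x y)%N.
Proof.
have copyP q S : S \in [set vinr q @: (e : {set _}) | e in E q.1] ->
    (exists v, vinr q v \in S) /\ S \subset copy_vtx t p m q.
  case/imsetP=> e /E_graph e2 ->; split; last exact/imsetS/subsetP.
  have /card_gt0P[v ve] : (0 < #|e|)%N by apply: leq_trans e2.
  by exists v; apply: imset_f.
have mixP q S : S \in mixed k (base_block t p m q.1) (copy_vtx t p m q) ->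
    [/\ exists v, vinr q v \in S, exists u, vinl u \in S &
        S \subset base_block t p m q.1 :|: copy_vtx t p m q].
  rewrite inE => /and4P[_ SUC /set0Pn[u /setIP[uS uU]] /set0Pn[v /setIP[vS vC]]].
  split=> //.
    by case/imsetP: vC vS => w _ -> wS; exists w.
  by case/imsetP: uU uS => w _ -> wS; exists w.
rewrite /corona corona_edgesE codegU; last first.
  apply/pred0P=> S /=; apply/negP=> /andP[/setUP SEE /bigcupP[q _ /mixP]].
  case=> [[v vS] [u uS] _]; case: SEE => [/imsetP[e _ SE]|].
    by rewrite SE in vS; case/imsetP: vS.
  case/bigcupP=> q' _ /copyP[_ /subsetP/(_ _ uS)].
  by rewrite mem_vinl_copy.
rewrite codegU; last first.
  apply/pred0P=> S /=; apply/negP=> /andP[/imsetP[e _ ->]].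
  by case/bigcupP=> q _ /copyP[[v /imsetP[]]].
congr (_ + _ + _)%N; rewrite codeg_bigcup // => q q' /negP qq'.
  apply/pred0P=> S /=; apply/negP=> /andP[/copyP[[v vS] _]].
  by move=> /copyP[_ /subsetP/(_ _ vS)]; rewrite mem_vinr_copy.
apply/pred0P=> S /=; apply/negP=> /andP[/mixP[[v vS] _ _]].
move=> /mixP[_ _ /subsetP/(_ _ vS)].
by rewrite inE mem_vinr_base mem_vinr_copy.
Qed.

(** Each of the [p] copies attached to a common block contributes equally, which is the source of
    the factor [p] in [a]. *)
Lemma codeg_corona_base u u' : u != u' ->
  codeg corona (vinl u) (vinl u')
  = (codeg E0 u u'
     + if blk u == blk u'
       then p * (binB - binz (p - 2) (k%:Z - 2)) else 0)%N.
Proof.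
move=> uu'; rewrite codeg_corona codeg_imset; last by move=> x y [].
rewrite [X in (_ + X + _)%N]big1 ?addn0 => [|q _]; last first.
  by apply: codeg_eq0 => S /imsetP[e _ ->] /imsetP[].
set B := (binB - _)%N;
have mixE q :
    codeg (mixed k (base_block t p m q.1) (copy_vtx t p m q)) (vinl u) (vinl u')
    = if (blk u == q.1) && (blk u' == q.1) then B else 0%N.
  have [uq|uq] /= := eqVneq (blk u) q.1; last first.
    by apply: codeg_mixed_out; rewrite inE mem_vinl_base mem_vinl_copy orbF.
  have [u'q|u'q] := eqVneq (blk u') q.1; last first.
    rewrite codegC; apply: codeg_mixed_out.
    by rewrite inE mem_vinl_base mem_vinl_copy orbF.
  have := @codeg_mixed_same _ k _ _ (vinl u) (vinl u')
            (disjoint_base_copy q.1 q).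
  rewrite !mem_vinl_base uq u'q eqxx card_base_block card_copy_vtx /B /binB => <- //.
  by rewrite addnK.
congr addn; rewrite (eq_bigr _ (fun q _ => mixE q)).
rewrite -(pair_bigA _ (fun i _ =>
  if (blk u == i) && (blk u' == i) then B else 0%N)) /=.
under eq_bigr do rewrite sum_nat_const card_ord.
rewrite (bigD1 (blk u)) //= eqxx big1 => [|i /negPf iu]; last first.
  by rewrite [blk u == i]eq_sym iu muln0.
by rewrite addn0 eq_sym; case: eqP => //; rewrite muln0.
Qed.

(** Only the joining edges of copy [q] can contain [vinr q v], and they reach only the block
    [q.1]. *)
Lemma codeg_corona_cross u q v :
  codeg corona (vinl u) (vinr q v)
  = if blk u == q.1 then binB else 0%N.
Proof.
rewrite codeg_corona codeg_eq0 => [|S /imsetP[e _ ->] _ /imsetP[]//].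
rewrite big1 ?add0n => [|q' _]; last first.
  by apply: codeg_eq0 => S /imsetP[e _ ->] /imsetP[].
rewrite (bigD1 q) //= big1 ?addn0 => [|q' q'q].
  case: eqP => [uq|/eqP uq].
    rewrite codeg_mixed_cross ?card_base_block ?card_copy_vtx //.
    - exact: disjoint_base_copy.
    - by rewrite mem_vinl_base uq.
    - by rewrite mem_vinr_copy.
  by apply: codeg_mixed_out; rewrite inE mem_vinl_base mem_vinl_copy orbF.
rewrite codegC; apply: codeg_mixed_out.
by rewrite inE mem_vinr_base mem_vinr_copy eq_sym.
Qed.

Lemma codeg_corona_copy q v q' v' : (q, v) != (q', v') ->
  codeg corona (vinr q v) (vinr q' v')
  = if q == q' then (codeg (E q.1) v v'
                     + (binB - binz (m - 2) (k%:Z - 2)))%N else 0%N.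
Proof.
move=> vv'; rewrite codeg_corona codeg_eq0 => [|S /imsetP[e _ ->] /imsetP[]//].
rewrite add0n (bigD1 q) //= [X in (_ + X + _)%N]big1 => [|i iq]; last first.
  apply: codeg_eq0 => S /imsetP[e _ ->] /imsetP[w _ []] qi; move: iq.
  by rewrite -qi eqxx.
rewrite (bigD1 q) //= [X in (_ + (_ + X))%N]big1 => [|i iq]; last first.
  by apply: codeg_mixed_out; rewrite inE mem_vinr_base mem_vinr_copy eq_sym.
rewrite !addn0; case: eqP => [qq'|/eqP qq'].
  rewrite -{q'}qq' in vv' *; rewrite codeg_imset => [|x y [] //].
  (* Both vertices now lie in the copy, so block and copy exchange roles through [mixedC]. *)
  have cb : [disjoint copy_vtx t p m q & base_block t p m q.1].
    by rewrite disjoint_sym disjoint_base_copy.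
  have := @codeg_mixed_same _ k _ _ (vinr q v) (vinr q v') cb.
  rewrite !mem_vinr_copy eqxx card_base_block card_copy_vtx mixedC [(m + p)%N]addnC.
  by rewrite /binB => <- //; rewrite addnK.
rewrite codeg_eq0 => [|S /imsetP[e _ ->] _ /imsetP[w _ []] /esym/eqP]; last first.
  by rewrite (negPf qq').
rewrite add0n codegC; apply: codeg_mixed_out.
by rewrite inE mem_vinr_base mem_vinr_copy eq_sym.
Qed.

End CoronaCodegree.

(** * Entries and column sums of the shifted Seidel matrices *)

Lemma leq_binz (x x' : nat) (y : int) : (x <= x')%N -> (binz x y <= binz x' y)%N.
Proof. by case: y => // y xx'; apply: leq_bin2l. Qed.

Lemma seidelmxE {R : pzRingType} {T : finType} {n : nat} {f : 'I_n -> T}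
    (E : {set {set T}}) i j : injective f ->
  seidelmx R f E i j
  = 1 - (f i == f j)%:R - 2 * (if f i == f j then 0 else (codeg E (f i) (f j))%:R).
Proof. by move=> f_inj; rewrite !mxE (inj_eq f_inj). Qed.

Lemma seidel_shiftE {R : comPzRingType} {m : nat} (E : {set {set 'I_m}})
    (c mu : R) v w :
  (seidel R E - (2 * c) *: (const_mx 1 - 1%:M) - const_mx 1 - mu%:M) v w
  = - (1 + mu - 2 * c) * (v == w)%:R - 2 * c
    - 2 * (if v == w then 0 else (codeg E v w)%:R).
Proof.
by rewrite !mxE -[mu *+ _]mulr_natr -/(codeg E v w); case: eqP => _; ring.
Qed.

(** The diagonal entry is [-(1 + mu)]; the other [m - 1] are [-2c] minus twice a codegree, and these
    codegrees sum to [r(k - 1)] by [sum_codeg]. The total is the [h] of the theorem. *)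
Lemma colsum_seidel_shift {R : comPzRingType} {m k r : nat} {E : {set {set 'I_m}}}
    (c mu : R) (v : 'I_m) :
    regular k r E ->
  \sum_w (seidel R E - (2 * c) *: (const_mx 1 - 1%:M) - const_mx 1 - mu%:M) w v
  = - (1 + 2 * r%:R * (k%:R - 1) + 2 * c * (m%:R - 1) + mu).
Proof.
move=> Er; rewrite (bigD1 v) //=.
rewrite (eq_bigr (fun w => - 2 * (codeg E v w)%:R - 2 * c)); last first.
  by move=> w wv; rewrite seidel_shiftE codegC (negPf wv) /=; ring.
rewrite sumrB -mulr_sumr -natr_sum sumr_const.
have := congr1 (fun n => n%:R : R) (sum_codeg v Er); rewrite natrD natrM.
move/(canRL (addrK _)) ->.
rewrite cardC1 card_ord seidel_shiftE eqxx.
by case: m v {E Er} => [[]//|m] v; rewrite -mulr_natl -(natr1 m) /=; ring.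
Qed.

Section CoronaSeidel.

Context {R : realFieldType} {t p m k : nat} {E0 : {set {set 'I_(t * p)}}}.
Context {E : 'I_t -> {set {set 'I_m}}} (mu : R).
Context (E_graph : forall i, is_hypergraph (E i)).

Let b : R := (binz (p + m - 2) (k%:Z - 2))%:R.
Let c : R := b - (binz (m - 2) (k%:Z - 2))%:R.
(** No separate value for [p = 1]: the factor of [a] in [corona_entry_base] vanishes when blocks are
    single vertices. *)
Let a : R := p%:R * (b - (binz (p - 2) (k%:Z - 2))%:R).
Let corona := corona_edges t p m k E0 E.

Let F (x y : corona_vtx t p m) : R :=
  1 - (x == y)%:R - 2 * (if x == y then 0 else (codeg corona x y)%:R)
  - mu * (x == y)%:R.

Lemma charP_corona : charP (seidelT R corona) mu = fdet F.
Proof.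
congr (\det _); apply/matrixP=> i j.
rewrite [RHS]mxE [LHS]mxE /seidelT seidelmxE; last first.
  exact: enum_val_inj.
by rewrite !mxE /F (inj_eq enum_val_inj) mulr_natr.
Qed.

Lemma corona_entry_base u u' :
  F (vinl u) (vinl u')
  = seidel R E0 u u' - 2 * a * ((blk u == blk u')%:R - (u == u')%:R)
    - mu * (u == u')%:R.
Proof.
have eq_vinl : (vinl u == vinl u' :> corona_vtx t p m) = (u == u').
  by apply/eqP/eqP => [[]|->].
rewrite /F seidelmxE // eq_vinl; have [->|uu'] := eqVneq u u'.
  by rewrite !eqxx /=; ring.
rewrite codeg_corona_base //; case: eqP => _; rewrite /a /b; 
  last by rewrite addn0 /=; ring.
(* By [leq_binz] the truncated subtraction of binomials is a genuine one in [R]. *)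
by rewrite natrD natrM natrB /=; [ring | apply: leq_binz; lia].
Qed.

Lemma corona_entry_cross u w :
  F (vinl u) (inr w) = 1 - 2 * b * (blk u == w.1.1)%:R.
Proof.
case: w => q v; rewrite /F (_ : _ == _ = false); last by apply/eqP.
rewrite (codeg_corona_cross E_graph u q v).
by case: eqP => _; rewrite /b /=; ring.
Qed.

Lemma corona_entryC x y : F x y = F y x.
Proof. by rewrite /F codegC eq_sym. Qed.

(** Splitting off the all-ones matrix leaves a block diagonal remainder, whence the [- const_mx 1]
    in each block. *)
Lemma corona_entry_copy w w' :
  F (inr w) (inr w')
  = 1 + (if w.1 == w'.1 then
           (seidel R (E w.1.1) - (2 * c) *: (const_mx 1 - 1%:M)
            - const_mx 1 - mu%:M) w.2 w'.2
         else 0).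
Proof.
case: w w' => [q v] [q' v'] /=.
have eq_vinr : (inr (q, v) == inr (q', v') :> corona_vtx t p m)
               = ((q, v) == (q', v')) by apply/eqP/eqP => [[-> ->]|[-> ->]].
rewrite /F eq_vinr; have [[-> ->]|vv'] := eqVneq (q, v) (q', v').
  by rewrite eqxx seidel_shiftE eqxx /=; ring.
rewrite (codeg_corona_copy E_graph _ _ _ _ vv').
move: vv'; have [<-|qq' _] := eqVneq q q'; last by rewrite /=; ring.
rewrite xpair_eqE eqxx /= => vv'.
rewrite seidel_shiftE (negPf vv') /c /b.
by rewrite natrD natrB /=; [ring | apply: leq_binz; lia].
Qed.

End CoronaSeidel.

(** * Assembly of the Schur complement *)

Lemma sum_copies {R : nzRingType} {t p m : nat} (G : 'I_t -> R) :
  \sum_(w : 'I_t * 'I_p * 'I_m) G w.1.1 = p%:R * m%:R * \sum_i G i.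
Proof.
rewrite -(pair_bigA _ (fun (q : 'I_t * 'I_p) (_ : 'I_m) => G q.1)) /=.
under eq_bigr do rewrite sumr_const card_ord.
rewrite -(pair_bigA _ (fun (i : 'I_t) (_ : 'I_p) => G i *+ m)) /= mulr_sumr.
apply: eq_bigr => i _; rewrite sumr_const card_ord.
by rewrite -[LHS]mulr_natl -[G i *+ m]mulr_natl mulrA.
Qed.

Lemma sum_indicator {R : nzRingType} {I : finType} (i0 : I) (G : I -> R) :
  \sum_i (i0 == i)%:R * G i = G i0.
Proof.
rewrite (bigD1 i0) //= eqxx mul1r big1 ?addr0 // => i.
by rewrite eq_sym => /negPf->; rewrite mul0r.
Qed.

Theorem theorem3p3 (R : realFieldType) (k r m p t : nat)
  (E0 : {set {set 'I_(t * p)}}) (E : 'I_t -> {set {set 'I_m}}) (mu : R) :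
  (1 <= p)%N -> (2 <= m)%N ->
  is_hypergraph E0 -> uniform k E0 ->
  (forall i, is_hypergraph (E i)) -> (forall i, regular k r (E i)) ->
  let a : R := if (2 <= p)%N
               then p%:R * ((binz (p + m - 2) (k%:Z - 2))%:R
                            - (binz (p - 2) (k%:Z - 2))%:R)
               else 0 in
  let b : R := (binz (p + m - 2) (k%:Z - 2))%:R in
  let c : R := b - (binz (m - 2) (k%:Z - 2))%:R in
  let Y (i : 'I_t) : 'M[R]_m := seidel R (E i) - (2 * c) *: (const_mx 1 - 1%:M) in
  let h : R := - (1 + 2 * r%:R * (k%:R - 1) + 2 * c * (m%:R - 1) + mu) in
  let pm : R := p%:R * m%:R in
  (forall i, Y i - const_mx 1 - mu%:M \in unitmx) ->
  h != 0 -> h + pm * t%:R != 0 ->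
  charP (seidelT R (corona_edges t p m k E0 E)) mu =
  (1 + pm * t%:R / h)
  * (\prod_(i < t) \det (Y i - const_mx 1 - mu%:M)) ^+ p
  * \det (seidel R E0
          + tensmx (1%:M : 'M[R]_t)
              (- (2 * a + 4%:R * pm * b ^+ 2 / h) *: (const_mx 1 : 'M[R]_p)
               + (2 * a - mu) *: 1%:M)
          - (pm / h * ((t%:R - 4%:R * b) - pm * (t%:R - 2 * b) ^+ 2 / (h + pm * t%:R)))
              *: const_mx 1).
Proof.
move=> p1 m2 _ _ E_graph E_reg a b c Y h pm _ h0 hpmt0.
rewrite charP_corona.
set F := (X in fdet X).
pose D i := Y i - const_mx 1 - mu%:M.
(* In [(B/h - sJ)(J + D0)] the multiple of [J] besides [B] is [pm(t - 2b)/h - s pmt - s h]; this [s]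
   makes it zero. *)
pose s : R := pm * (t%:R - 2 * b) / (h * (h + pm * t%:R)).
pose X (u : 'I_(t * p)) (w : 'I_t * 'I_p * 'I_m) : R :=
  (1 - 2 * b * (blk u == w.1.1)%:R) / h - s.
pose D0 (w w' : 'I_t * 'I_p * 'I_m) : R :=
  if w.1 == w'.1 then D w.1.1 w.2 w'.2 else 0.
have Fcopy w w' : F (inr w) (inr w') = 1 + D0 w w'.
  exact: corona_entry_copy.
have Fcross u w : F (inl u) (inr w) = 1 - 2 * b * (blk u == w.1.1)%:R.
  exact: corona_entry_cross.
have FcrossC u w : F (inr w) (inl u) = 1 - 2 * b * (blk u == w.1.1)%:R.
  by rewrite -Fcross /F corona_entryC.
(* Weights depending only on the block index are scaled by [h]; both [B] and [X] have rows of this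
   kind. *)
have D0_colsum (G : 'I_t -> R) w' : \sum_w G w.1.1 * D0 w w' = h * G w'.1.1.
  rewrite -(pair_bigA _ (fun q v => G q.1 * D0 (q, v) w')) /=.
  rewrite (bigD1 w'.1) //= [X in _ + X]big1 ?addr0 => [|q /negPf qw].
    rewrite -mulr_sumr mulrC /D0 /= eqxx; congr (_ * _).
    exact: colsum_seidel_shift.
  by apply: big1 => v _; rewrite /D0 /= qw mulr0.
(* The formula for [h] has served for the column sums; from here [h] is an atom for [field]. *)
clearbody h; have sumX (G : 'I_t -> R) (u : 'I_(t * p)) :
    \sum_w X u w * G w.1.1
    = pm * ((h^-1 - s) * \sum_i G i - 2 * b / h * G (blk u)).
  rewrite (sum_copies (fun i => ((1 - 2 * b * (blk u == i)%:R) / h - s) * G i)).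
  congr (_ * _); rewrite -(sum_indicator (blk u) G) !mulr_sumr -sumrB.
  by apply: eq_bigr => i _; ring.
rewrite (@fdet_schur _ 'I_(t * p) ('I_t * 'I_p * 'I_m)%type F X); last first.
  move=> u w; rewrite Fcross.
  under eq_bigr do rewrite Fcopy mulrDr.
  rewrite big_split (sumX (fun=> 1)) /=.
  rewrite (D0_colsum (fun i => (1 - 2 * b * (blk u == i)%:R) / h - s)).
  rewrite sumr_const card_ord /s; field.
  by rewrite hpmt0 h0.
rewrite [LHS]mulrC; congr (_ * _).
  rewrite (eq_fdet Fcopy) (fdet_add1 h0) => [|w]; last first.
    rewrite -[RHS]mulr1 -(D0_colsum (fun=> 1) w).
    by apply: eq_bigr => v _; rewrite mul1r.
  rewrite !card_prod !card_ord -/D0; congr (_ * _).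
    by rewrite !natrM /pm; ring.
  (* The block of copy [(i, j)] depends only on [i], so each determinant occurs [p] times. *)
  rewrite (@fdet_blocks _ _ _ (fun q => D q.1)).
  under eq_bigr do rewrite fdet_ord.
  rewrite -(pair_bigA _ (fun i _ => \det (D i))) /= -prodrXl.
  by apply: eq_bigr => i _; rewrite prodr_const card_ord.
rewrite -fdet_ord; apply: eq_fdet => u u'.
under eq_bigr do rewrite FcrossC.
rewrite (sumX (fun i => 1 - 2 * b * (blk u' == i)%:R)).
have -> : \sum_i (1 - 2 * b * (blk u' == i)%:R) = t%:R - 2 * b :> R.
  rewrite sumrB sumr_const card_ord; congr (_ - _).
  rewrite -[RHS](sum_indicator (blk u') (fun=> 2 * b)).
  by apply: eq_bigr => i _; rewrite mulrC.
have -> : F (inl u) (inl u') = _ := corona_entry_base mu E_graph u u'.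
(* Block and position within the block determine a vertex; the entries are compared for different
   blocks, equal vertices, and distinct positions in one block. *)
have eq_u : (u == u') = (blk u == blk u')
                        && ((mxtens_unindex u).2 == (mxtens_unindex u').2).
  by rewrite -(can_eq (@mxtens_unindexK t p)) -pair_eqE.
rewrite [RHS]mxE [(seidel R E0 + _) u u']mxE; move: (seidel R E0 u u') => x.
rewrite !mxE -/(blk u) -/(blk u') eq_u [blk u' == _]eq_sym.
have [_|_] /= := eqVneq (blk u) (blk u'); last first.
  by rewrite /s; field; rewrite hpmt0 h0.
have [_|jj'] /= := eqVneq; first by rewrite /s; field; rewrite hpmt0 h0.
(* Only in this case does the value of [a] matter, since it cancels in the other two. Two distinct
   positions force [2 <= p], which selects the first branch. *)
have aE : a = p%:R * (b - (binz (p - 2) (k%:Z - 2))%:R).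
  rewrite /a; case: leqP => // p_lt2; case/negP: jj'; rewrite -val_eqE.
  move: (mxtens_unindex u).2 (mxtens_unindex u').2 => [j j_ltp] [j' j'_ltp] /=.
  lia.
by rewrite -aE /s; field; rewrite hpmt0 h0.
Qed.
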